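(* Let $\alpha_0>\alpha_1>\alpha_2>\cdots$ be the zeros of the Digamma function $\psi$. Then $$\sum_{k=0}^\infty\frac{1}{\alpha_k^2}=\gamma^2+\frac{\pi^2}{2},$$ where $\gamma$ is the Euler constant.
   Context: $\psi(z)=\Gamma'(z)/\Gamma(z)$, $z\in\mathbb C\setminus\{0,-1,-2,\dots\}$, is the Digamma function, with $\Gamma$ the Euler gamma function. It is known that all zeros of $\psi$ are real and simple, and that all of them except one are negative; $\alpha_k$ denotes the $k$th zero counted from the right, so $\alpha_0=1.461632\dots$ is the unique positive zero. *)

(* Defs.v *)
(* Stdlib reals with Coquelicot's complex numbers. *)
From Stdlib Require Import Reals Factorial.
From Coquelicot Require Import Coquelicot.

Open Scope R_scope.

Definition Cexp (z : C) : C :=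
  (exp (Re z) * cos (Im z), exp (Re z) * sin (Im z)).

(* z (z + 1) ... (z + n), with n + 1 factors *)
Fixpoint Crising (z : C) (n : nat) : C :=
  match n with
  | O => z
  | S m => (Crising z m * (z + RtoC (INR n)))%C
  end.

(* n! n^z / (z (z + 1) ... (z + n)), with n^z = exp (z ln n) for n >= 1; the
   value at n = 0 is irrelevant to the limit below. *)
Definition Gamma_seq (z : C) (n : nat) : C :=
  (RtoC (INR (fact n)) * Cexp (z * RtoC (ln (INR n))) / Crising z n)%C.

(* Euler's definition of the gamma function as a limit. It applies directly on
   all of C minus the nonpositive integers (not only on Re z > 0); the limit is
   taken on real and imaginary parts. The values at the poles are
   meaningless. *)
Definition Gamma (z : C) : C :=
  (real (Lim_seq (fun n => Re (Gamma_seq z n))),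
   real (Lim_seq (fun n => Im (Gamma_seq z n)))).

Definition nonpos_integer (z : C) : Prop :=
  exists n : nat, z = RtoC (- INR n).

(* C_derive is total; it is the complex derivative wherever the function is
   complex differentiable (is_C_derive_unique), hence off the poles of Gamma. *)
Definition digamma (z : C) : C := (C_derive Gamma z / Gamma z)%C.

Definition digamma_zero (z : C) : Prop :=
  ~ nonpos_integer z /\ digamma z = RtoC 0.

Definition Euler_gamma : R :=
  real (Lim_seq (fun n => sum_n_m (fun k => / INR k) 1 n - ln (INR n))).

(* Main.v *)
(** Euler's product gives psi(x) as the limit of
    T_n(x) = ln n - sum_(j <= n) 1 / (x + j), and T_n = ln n - P'/P with
    P = x (x + 1) ... (x + n). So the zeros of T_n are the roots of the polynomial
    P' - (ln n) P, one in each interval (-k, 1 - k) for 1 <= k <= n and one in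
    (0, oo), and the first three coefficients give the sum of their inverse
    squares: (H_n - ln n)^2 + 3 sum_(j <= n) 1 / j^2. As n grows, each zero of T_n
    tends to the zero of psi in the same interval, and the sums pass to the limit
    because the k-th term is at most 1 / (k - 1)^2. *)

Require Import Defs.
From Stdlib Require Import Reals Factorial Ranalysis5 Lra Lia ClassicalEpsilon.
From Coquelicot Require Import Coquelicot.
From mathcomp Require all_boot ssralg poly ring Rstruct.
Open Scope R_scope.

(** * Roots of the logarithmic derivative of a polynomial *)

(** The digamma function is given as a complex derivative of a limit, but [alpha_zeros] makes every
    zero real, so it is enough to know [digamma] at real points. The obstacle there is to
    differentiate through the limit that defines [Gamma]. On a bounded interval Euler's product is
    split into a finite factor, which carries the poles, and the exponential of a tail whose
    derivatives converge uniformly. The hypotheses do not say where [alpha k] lies either: that it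
    is in the k-th interval is deduced from the order of the sequence and from its listing all
    zeros. The factor 3 comes from the derivative. With P = X R and R of coefficients r_i, the
    polynomial P' - L P has coefficients (i + 1) r_i - L r_(i-1), and expanding (q_1 / q_0)^2 - 2
    q_2 / q_0 leaves three times the power sum of R. Hence the term 3 (PI^2 / 6) = PI^2 / 2 of the
    limit; the sum of 1 / j^2 is evaluated here as well, by elementary trigonometry. *)

Section LogDerivRoots.
Import all_boot ssralg poly GRing.Theory.
Import mathcomp.algebra_tactics.ring Rstruct.
Local Open Scope ring_scope.

(** Newton's identities for the inverse roots. In the induction, multiplying by ['X - b%:P] turns
    the low coefficients x0, x1, x2 into - b x0, x0 - b x1, x1 - b x2, and the two auxiliary
    identities check that each side then gains the contribution of [b]. *)
Lemma prod_XsubC_coef_sums (F : fieldType) (s : seq F)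
    (p := \prod_(b <- s) ('X - b%:P)) : 0 \notin s ->
  [/\ p`_0 != 0, \sum_(b <- s) b^-1 = - (p`_1 / p`_0) &
      \sum_(b <- s) b^-1 ^+ 2 = (p`_1 / p`_0) ^+ 2 - 2%:R * (p`_2 / p`_0)].
Proof.
rewrite {}/p; elim: s => [|b s IHs].
  by rewrite !big_nil !coefC /= oner_eq0 !mul0r oppr0 expr0n mulr0 subr0.
rewrite inE negb_or eq_sym => /andP[b0 /IHs]; rewrite !big_cons.
set p := \prod_(_ <- s) _ => -[p0 -> ->]; clearbody p.
rewrite !mulrBl !coefB !coefXM !coefCM /= sub0r.
have addr_inv (x0 x1 : F) : x0 != 0 ->
    b^-1 - x1 / x0 = - ((x0 - b * x1) / (- (b * x0))).
  by move=> x0n; field; rewrite oppr_eq0 mulf_neq0 ?b0 ?x0n.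
have addr_inv_sqr (x0 x1 x2 : F) : x0 != 0 ->
    b^-1 ^+ 2 + ((x1 / x0) ^+ 2 - 2%:R * (x2 / x0)) =
    ((x0 - b * x1) / (- (b * x0))) ^+ 2
    - 2%:R * ((x1 - b * x2) / (- (b * x0))).
  by move=> x0n; field; rewrite oppr_eq0 mulf_neq0 ?b0 ?x0n.
by split; [rewrite oppr_eq0 mulf_neq0 | exact: addr_inv | exact: addr_inv_sqr].
Qed.

(** With as many distinct roots as its degree, [p] is a scalar multiple of the product of its linear
    factors, and ratios of coefficients do not see the scalar. *)
Lemma root_sum_inv_sqr (F : fieldType) (p : {poly F}) (s : seq F) :
    size p = (size s).+1 -> uniq s -> all (root p) s -> p`_0 != 0 ->
  \sum_(b <- s) b^-1 ^+ 2 = (p`_1 / p`_0) ^+ 2 - 2%:R * (p`_2 / p`_0).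
Proof.
move=> sz us rs p0.
have s0 : 0 \notin s.
  by apply: contra p0 => /(allP rs); rewrite rootE horner_coef0.
have pE := all_roots_prod_XsubC sz rs; rewrite uniq_rootsE in pE.
have [q0 _ ->] := @prod_XsubC_coef_sums F s s0.
have c0 : lead_coef p != 0.
  by apply: contra p0; rewrite lead_coef_eq0 => /eqP ->; rewrite coef0.
rewrite (pE us) !coefZ; set q := \prod_(_ <- s) _ in q0 *.
have scaleK (x : F) : lead_coef p * x / (lead_coef p * q`_0) = x / q`_0.
  by rewrite -mulf_div divff ?mul1r.
by rewrite !scaleK.
Qed.

Lemma deriv_prod_XaddC (F : fieldType) (n : nat) (a : nat -> F) (x : F) :
    (forall j, (j < n)%N -> x + a j != 0) ->
  let p := \prod_(0 <= j < n) ('X + (a j)%:P) in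
  p.[x] != 0 /\ p^`().[x] = p.[x] * \sum_(0 <= j < n) (x + a j)^-1.
Proof.
elim: n => [|n IHn] xa /=.
  by rewrite !big_nil derivC !hornerE oner_eq0.
rewrite !big_nat_recr //=; set p := \prod_(_ <= _ < _) _ in IHn *.
have /= [|p0 dp] := IHn; first by move=> j /ltnW; apply: xa.
have xn := xa n (ltnSn n).
rewrite derivM derivD derivX derivC !hornerE dp mulf_neq0 //; split=> //.
by field.
Qed.

(* The terms j = 0 on the right vanish, as 0^-1 = 0. *)
Lemma log_deriv_roots_sum_inv_sqr (F : fieldType) (n : nat) (L : F) (b : nat -> F) :
    L != 0 -> (forall j, (0 < j <= n)%N -> j%:R != 0 :> F) ->
    {in gtn n.+1 &, injective b} ->
    (forall k j, (k < n.+1)%N -> (j < n.+1)%N -> b k + j%:R != 0) ->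
    (forall k, (k < n.+1)%N -> \sum_(0 <= j < n.+1) (b k + j%:R)^-1 = L) ->
  \sum_(0 <= k < n.+1) (b k)^-1 ^+ 2 =
    (\sum_(0 <= j < n.+1) j%:R^-1 - L) ^+ 2
    + 3%:R * \sum_(0 <= j < n.+1) j%:R^-1 ^+ 2.
Proof.
rewrite !(big_ltn (ltn0Sn n)) !invr0 expr0n /= !add0r -(big_ltn (ltn0Sn n)) /=.
move=> L0 n0 b_inj b_pole b_zero.
(* The root 0 of [p] has no inverse, so the power sums of the 1 / j are read off the cofactor
   [r]. *)
pose r : {poly F} := \prod_(1 <= j < n.+1) ('X + j%:R%:P).
pose p := 'X * r; pose q := p^`() - L *: p.
have pE : p = \prod_(0 <= j < n.+1) ('X + j%:R%:P).
  by rewrite big_nat_recl // addr0 /p /r big_add1.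
have rE : r = \prod_(c <- [seq - j%:R | j <- index_iota 1 n.+1]) ('X - c%:P).
  by rewrite big_map /r; apply: eq_bigr => j _; rewrite polyCN opprK.
have szr : size r = n.+1.
  by rewrite rE size_prod_XsubC size_map size_iota subSS subn0.
have szp : size p = n.+2 by rewrite /p mulrC size_mulX ?szr // -size_poly_eq0 szr.
have [|r0 r1 r2] := @prod_XsubC_coef_sums F
    [seq - j%:R | j <- index_iota 1 n.+1].
  apply/mapP => -[j]; rewrite mem_index_iota ltnS => /n0/negP jn /eqP.
  by rewrite eq_sym oppr_eq0.
rewrite -rE !big_map in r0 r1 r2.
have -> : \sum_(1 <= j < n.+1) j%:R^-1 = r`_1 / r`_0.
  by rewrite -[RHS]opprK -r1 -sumrN; apply: eq_bigr => j _; rewrite invrN opprK.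
have -> : \sum_(1 <= j < n.+1) (j%:R^-1 : F) ^+ 2 =
    (r`_1 / r`_0) ^+ 2 - 2%:R * (r`_2 / r`_0).
  by rewrite -r2; apply: eq_bigr => j _; rewrite invrN sqrrN.
have q0 : q`_0 = r`_0 by rewrite coefB coefZ coef_deriv !coefXM /= mulr0 subr0.
have q1 : q`_1 = 2%:R * r`_1 - L * r`_0.
  by rewrite coefB coefZ coef_deriv !coefXM /= mulr_natl.
have q2 : q`_2 = 3%:R * r`_2 - L * r`_1.
  by rewrite coefB coefZ coef_deriv !coefXM /= mulr_natl.
(* Since [L] is nonzero, [q] keeps the degree of [p], so the n + 1 values of [b] exhaust its
   roots. *)
have szq : size q = n.+2.
  rewrite /q addrC size_polyDl size_polyN size_scale // szp //.
  by rewrite (leq_ltn_trans (size_poly _ _)) ?szp.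
rewrite -(big_map b xpredT (fun x => x^-1 ^+ 2)) (@root_sum_inv_sqr _ q).
- have square_expand (x0 x1 x2 : F) : x0 != 0 ->
      ((2%:R * x1 - L * x0) / x0) ^+ 2
      - 2%:R * ((3%:R * x2 - L * x1) / x0) =
      (x1 / x0 - L) ^+ 2 + 3%:R * ((x1 / x0) ^+ 2 - 2%:R * (x2 / x0)).
    by move=> x0n; field.
  by rewrite q0 q1 q2; exact: square_expand.
- by rewrite szq size_map size_iota subn0.
- rewrite map_inj_in_uniq ?iota_uniq // => i j.
  by rewrite !mem_index_iota !leq0n /= => ? ?; apply: b_inj.
(* At [b k] the derivative of [p] is the value of [p] times the sum of the 1 / (b k + j), which is
   [L]. *)
- apply/allP => _ /mapP[k + ->]; rewrite mem_index_iota leq0n /= => kn.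
  rewrite rootE /q hornerD hornerN hornerZ pE.
  have /= [|_ ->] := @deriv_prod_XaddC F n.+1 (fun j => j%:R) (b k).
    by move=> j; apply: b_pole.
  by rewrite b_zero // mulrC subrr.
- by rewrite q0.
Qed.

Local Open Scope R_scope.

Lemma sum_n_bigop (u : nat -> R) (n : nat) : sum_n u n = (\sum_(0 <= k < n.+1) u k)%R.
Proof. by rewrite sum_n_Reals sum_f_R0E. Qed.

(** Transfer to the Stdlib reals. The terms j = 0 keep their value, because both inverses send 0 to
    0. *)
Lemma real_log_deriv_roots_sum_inv_sqr (n : nat) (L : R) (b : nat -> R) :
  L <> 0 ->
  (forall i j : nat, (i <= n)%coq_nat -> (j <= n)%coq_nat -> b i = b j -> i = j) ->
  (forall k j : nat, (k <= n)%coq_nat -> b k + INR j <> 0) ->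
  (forall k : nat, (k <= n)%coq_nat -> sum_n (fun j => / (b k + INR j)) n = L) ->
  sum_n (fun k => / b k ^ 2) n =
    (sum_n (fun j => / INR j) n - L) ^ 2 + 3 * sum_n (fun j => / INR j ^ 2) n.
Proof.
move=> L0 b_inj b_pole b_zero.
have sqr (x : R) : / x ^ 2 = (x^-1 ^+ 2)%R by rewrite RinvE RpowE exprVn.
rewrite !sum_n_bigop RpowE RplusE RminusE RmultE.
under eq_bigr => k _ do rewrite sqr.
under [X in (_ + _ * X)%R]eq_bigr => j _ do rewrite sqr INRE.
under [X in ((X - _) ^+ 2)%R]eq_bigr => j _ do rewrite RinvE INRE.
rewrite (_ : IZR 3 = 3%:R%R); last by rewrite -INRE INR_IZR_INZ.
apply: log_deriv_roots_sum_inv_sqr.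
- exact/eqP.
- move=> j /andP[j0 _]; rewrite -INRE; apply/eqP/not_0_INR.
  by move=> j_eq0; rewrite j_eq0 in j0.
- move=> i j; rewrite !inE !ltnS => /leP ni /leP nj; exact: b_inj.
- move=> k j; rewrite ltnS => /leP nk _; rewrite -INRE; exact/eqP/b_pole.
- move=> k; rewrite ltnS => /leP nk; rewrite -[RHS](b_zero k nk) sum_n_bigop.
  by apply: eq_bigr => j _; rewrite RinvE RplusE INRE.
Qed.

End LogDerivRoots.

(** * The sum of the inverse squares *)

Lemma sum_f_R0_rev (u : nat -> R) (n : nat) :
  sum_f_R0 (fun k => u (n - k)%nat) n = sum_f_R0 u n.
Proof.
revert u; induction n as [|n IHn]; intros u; [reflexivity|].
rewrite tech5, Nat.sub_diag, (decomp_sum u) by lia; simpl pred.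
rewrite <- (IHn (fun k => u (S k))), Rplus_comm; f_equal.
apply sum_eq; intros k kn; f_equal; lia.
Qed.

Lemma inv_sqr_sin_double (y : R) : 0 < y < PI / 2 ->
  / sin y ^ 2 + / sin (PI / 2 - y) ^ 2 = 4 * / sin (2 * y) ^ 2.
Proof.
intros Hy; rewrite sin_shift, sin_2a.
assert (Hs : 0 < sin y) by (apply sin_gt_0; lra).
assert (Hc : 0 < cos y) by (apply cos_gt_0; lra).
assert (H := sin2_cos2 y); unfold Rsqr in H.
replace (/ sin y ^ 2 + / cos y ^ 2)
  with ((sin y * sin y + cos y * cos y) / (sin y ^ 2 * cos y ^ 2)) by (field; lra).
rewrite H; field; lra.
Qed.

(* Iterates the duplication formula from sin (PI / 4). Since 1 / x^2 lies between
   1 / sin(x)^2 - 1 and 1 / sin(x)^2, this determines the sum of 1 / (2k + 1)^2. *)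
Lemma sum_inv_sqr_sin (n : nat) :
  sum_f_R0 (fun k => / sin ((2 * INR k + 1) * PI / (4 * 2 ^ n)) ^ 2)
    (Nat.pred (2 ^ n)) = 2 * 4 ^ n.
Proof.
induction n as [|n IHn].
- simpl; replace ((2 * 0 + 1) * PI / (4 * 1)) with (PI / 4) by field.
  rewrite sin_PI4.
  assert (H := sqrt_sqrt 2 ltac:(lra)); assert (0 < sqrt 2) by (apply sqrt_lt_R0; lra).
  replace (/ (1 / sqrt 2 * (1 / sqrt 2 * 1))) with (sqrt 2 * sqrt 2) by (field; lra).
  lra.
- set (m := (2 ^ n)%nat) in *.
  assert (m0 : (0 < m)%nat) by (apply Nat.neq_0_lt_0, Nat.pow_nonzero; lia).
  assert (mE : 2 ^ n = INR m) by (unfold m; rewrite pow_INR; reflexivity).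
  replace (Nat.pred (2 ^ S n)) with (S (2 * Nat.pred m))%nat
    by (simpl; fold m; lia).
  (* The 2m terms are cut in the middle and the upper half is reversed: index k then meets 2m - 1 -
     k, whose angle is PI / 2 - y. *)
  rewrite (tech2 _ (Nat.pred m)) by lia.
  replace (S (2 * Nat.pred m) - S (Nat.pred m))%nat with (Nat.pred m) by lia.
  rewrite <- (sum_f_R0_rev (fun i => / sin ((2 * INR (S (Nat.pred m) + i) + 1) * _ / _) ^ 2)).
  rewrite <- sum_plus; simpl (4 ^ S n).
  replace (2 * (4 * 4 ^ n)) with (4 * (2 * 4 ^ n)) by ring.
  rewrite <- IHn, scal_sum; apply sum_eq; intros k km.
  assert (Hm : 0 < INR m) by (apply lt_0_INR; lia).
  assert (Hk : INR k + 1 <= INR m) by (rewrite <- S_INR; apply le_INR; lia).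
  assert (Hk0 := pos_INR k); assert (Hpi := PI_RGT_0).
  set (y := (2 * INR k + 1) * PI / (4 * 2 ^ S n)).
  replace ((2 * INR (S (Nat.pred m) + (Nat.pred m - k)) + 1) * PI / (4 * 2 ^ S n))
    with (PI / 2 - y).
  2: { unfold y; replace (S (Nat.pred m) + (Nat.pred m - k))%nat
         with (2 * m - (k + 1))%nat by lia.
       rewrite minus_INR, mult_INR, plus_INR by lia; simpl; rewrite mE; field; lra. }
  replace ((2 * INR k + 1) * PI / (4 * 2 ^ n)) with (2 * y)
    by (unfold y; simpl; rewrite mE; field; lra).
  rewrite inv_sqr_sin_double; [ring|].
  unfold y; simpl; rewrite mE; split.
  + apply Rdiv_lt_0_compat; [apply Rmult_lt_0_compat|]; lra.
  + apply (Rmult_lt_reg_r (4 * (2 * INR m))); [lra|]; field_simplify; nra.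
Qed.

(** Both bounds come from x cos x <= sin x <= x, since 1 / sin(x)^2 - 1 is the square of the
    cotangent. The left inequality holds because sin t - t cos t has derivative t sin t >= 0. *)
Lemma inv_sqr_sin_bounds (x : R) : 0 < x < PI / 2 ->
  / sin x ^ 2 - 1 <= / x ^ 2 <= / sin x ^ 2.
Proof.
intros Hx.
assert (Hs : 0 < sin x) by (apply sin_gt_0; lra).
assert (Hc : 0 < cos x) by (apply cos_gt_0; lra).
assert (Hsx := sin_lt_x x (proj1 Hx)).
assert (Hxc : x * cos x <= sin x).
{ destruct (MVT_gen (fun t => sin t - t * cos t) 0 x (fun t => t * sin t)) as [c [Hc' E]].
  - intros t _; auto_derive; [trivial | ring].
  - intros t _; apply continuity_pt_filterlim, (ex_derive_continuous (fun t => sin t - t * cos t)).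
    auto_derive; trivial.
  - rewrite Rmin_left, Rmax_right in Hc' by lra.
    rewrite sin_0 in E.
    assert (0 <= sin c) by (apply sin_ge_0; lra).
    assert (0 <= c * sin c * (x - 0)) by (repeat apply Rmult_le_pos; lra).
    lra. }
split.
- assert (H := sin2_cos2 x); unfold Rsqr in H.
  replace (/ sin x ^ 2 - 1) with ((cos x / sin x) ^ 2)
    by (replace ((cos x / sin x) ^ 2) with (cos x ^ 2 / sin x ^ 2) by (field; lra);
        replace (cos x ^ 2) with (1 - sin x ^ 2) by lra; field; lra).
  rewrite <- pow_inv; apply pow_incr; split.
  + apply Rlt_le, Rdiv_lt_0_compat; lra.
  + apply (Rmult_le_reg_r (x * sin x)); [nra|]; field_simplify; lra.
- apply Rinv_le_contravar; [apply pow_lt; lra | apply pow_incr; lra].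
Qed.

Lemma sum_f_R0_minus_one (u : nat -> R) (n : nat) :
  sum_f_R0 (fun k => u k - 1) n = sum_f_R0 u n - INR (S n).
Proof. rewrite minus_sum, sum_cte; ring. Qed.

(** The sine bounds are summed over the 2^n angles [x k]. The sum of 1 / sin^2 is 2 * 4^n, and
    dividing by 16 * 4^n / PI^2 gives PI^2 / 8. The loss of 1 per term costs 2^n in all, which is
    the fraction 1 / 2^(n+1) of the main term. *)
Lemma sum_inv_sqr_odd_bounds (n : nat) :
  (1 - / 2 ^ S n) * (PI ^ 2 / 8)
  <= sum_f_R0 (fun k => / (2 * INR k + 1) ^ 2) (Nat.pred (2 ^ n)) <= PI ^ 2 / 8.
Proof.
assert (Hpi := PI_RGT_0).
assert (m0 : (0 < 2 ^ n)%nat) by (apply Nat.neq_0_lt_0, Nat.pow_nonzero; lia).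
assert (mE : INR (2 ^ n) = 2 ^ n) by (rewrite pow_INR; reflexivity).
assert (Hm : 0 < 2 ^ n) by (apply pow_lt; lra).
assert (E4 : 4 ^ n = 2 ^ n * 2 ^ n) by (rewrite <- Rpow_mult_distr; f_equal; ring).
set (x k := (2 * INR k + 1) * PI / (4 * 2 ^ n)).
assert (Hx : forall k, (k <= Nat.pred (2 ^ n))%nat -> 0 < x k < PI / 2).
{ intros k Hk; assert (Hk0 := pos_INR k).
  assert (INR k + 1 <= 2 ^ n) by (rewrite <- mE, <- S_INR; apply le_INR; lia).
  unfold x; split.
  - apply Rdiv_lt_0_compat; [apply Rmult_lt_0_compat|]; lra.
  - apply (Rmult_lt_reg_r (4 * 2 ^ n)); [lra|]; field_simplify; nra. }
assert (E : sum_f_R0 (fun k => / x k ^ 2) (Nat.pred (2 ^ n)) =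
   16 * 4 ^ n / PI ^ 2 * sum_f_R0 (fun k => / (2 * INR k + 1) ^ 2) (Nat.pred (2 ^ n))).
{ rewrite scal_sum; apply sum_eq; intros k _; assert (Hk0 := pos_INR k).
  unfold x; rewrite E4; field; lra. }
assert (Hlo := sum_Rle (fun k => / sin (x k) ^ 2 - 1) (fun k => / x k ^ 2) (Nat.pred (2 ^ n))
  (fun k Hk => proj1 (inv_sqr_sin_bounds _ (Hx k Hk)))).
assert (Hhi := sum_Rle (fun k => / x k ^ 2) (fun k => / sin (x k) ^ 2) (Nat.pred (2 ^ n))
  (fun k Hk => proj2 (inv_sqr_sin_bounds _ (Hx k Hk)))).
rewrite sum_f_R0_minus_one in Hlo; unfold x in Hlo at 1, Hhi at 2.
rewrite sum_inv_sqr_sin, E in *.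
replace (S (Nat.pred (2 ^ n))) with (2 ^ n)%nat in Hlo by lia; rewrite mE, E4 in *.
assert (Hp2 : 0 < PI ^ 2) by (apply pow_lt; lra).
assert (C : 0 < PI ^ 2 / (16 * (2 ^ n * 2 ^ n)))
  by (apply Rdiv_lt_0_compat; [|apply Rmult_lt_0_compat; [|apply Rmult_lt_0_compat]]; lra).
split.
- apply Rmult_le_compat_r with (1 := Rlt_le _ _ C) in Hlo.
  field_simplify in Hlo; [|lra ..].
  apply Rle_trans with (2 := Hlo); right; simpl; field; lra.
- apply Rmult_le_compat_r with (1 := Rlt_le _ _ C) in Hhi.
  field_simplify in Hhi; [|lra ..]; lra.
Qed.

(** The bounds concern only partial sums of 2^n terms. Monotonicity gives convergence of the whole
    sequence, and this subsequence identifies the limit. *)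
Lemma is_series_inv_sqr_odd : is_series (fun k => / (2 * INR k + 1) ^ 2) (PI ^ 2 / 8).
Proof.
set (u k := / (2 * INR k + 1) ^ 2).
assert (u0 : forall k, 0 <= u k).
{ intros k; apply Rlt_le, Rinv_0_lt_compat, pow_lt; assert (H := pos_INR k); lra. }
assert (incr : forall n, sum_n u n <= sum_n u (S n)).
{ intros n; rewrite sum_Sn; unfold plus; simpl; specialize (u0 (S n)); lra. }
assert (pow_gt : forall n, (n <= Nat.pred (2 ^ n))%nat)
  by (intros n; assert (H := Nat.pow_gt_lin_r 2 n ltac:(lia)); lia).
assert (mono : forall n m, (n <= m)%nat -> sum_n u n <= sum_n u m).
{ intros n m; induction 1; [lra | specialize (incr m); lra]. }
assert (bounds := fun n => sum_inv_sqr_odd_bounds n).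
fold u in bounds.
assert (Hex : ex_finite_lim_seq (sum_n u)).
{ apply ex_finite_lim_seq_incr with (PI ^ 2 / 8); [exact incr|].
  intros n; apply Rle_trans with (1 := mono _ _ (pow_gt n)).
  rewrite sum_n_Reals; apply bounds. }
destruct Hex as [l Hl].
assert (Hsub : is_lim_seq (fun n => sum_n u (Nat.pred (2 ^ n))) l).
{ apply (is_lim_seq_subseq (sum_n u)); [|exact Hl].
  intros P [N HN]; exists N; intros n Hn; apply HN.
  specialize (pow_gt n); lia. }
assert (Hlim : is_lim_seq (fun n => sum_n u (Nat.pred (2 ^ n))) (PI ^ 2 / 8)).
{ apply is_lim_seq_le_le with (fun n => (1 - (/ 2) ^ S n) * (PI ^ 2 / 8)) (fun _ => PI ^ 2 / 8).
  - intros n; rewrite sum_n_Reals, pow_inv; apply bounds.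
  - replace (Finite (PI ^ 2 / 8)) with (Finite ((1 - 0) * (PI ^ 2 / 8))) by (f_equal; ring).
    apply is_lim_seq_mult'; [|apply is_lim_seq_const].
    apply is_lim_seq_minus'; [apply is_lim_seq_const|].
    apply (is_lim_seq_incr_1 (fun n => (/ 2) ^ n)), is_lim_seq_geom.
    rewrite Rabs_pos_eq; lra.
  - apply is_lim_seq_const. }
apply is_lim_seq_unique in Hsub; apply is_lim_seq_unique in Hlim.
replace (PI ^ 2 / 8) with l by congruence; exact Hl.
Qed.

(* A series over n >= 1 splits into its odd and even terms, and the even terms
   of sum 1/n^2 make up a quarter of the whole. *)
Lemma is_series_inv_sqr : is_series (fun k => / (INR k + 1) ^ 2) (PI ^ 2 / 6).
Proof.
set (u k := / (INR k + 1) ^ 2); set (v k := / (2 * INR k + 1) ^ 2).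
assert (u0 : forall k, 0 <= u k).
{ intros k; apply Rlt_le, Rinv_0_lt_compat, pow_lt; assert (H := pos_INR k); lra. }
assert (even : forall k, u (2 * k)%nat = v k)
  by (intros k; unfold u, v; rewrite mult_INR; reflexivity).
assert (odd : forall k, u (S (2 * k)) = / 4 * u k).
{ intros k; assert (H := pos_INR k); unfold u; rewrite S_INR, mult_INR; simpl; field; lra. }
assert (split : forall n, sum_n u (S (2 * n)) = sum_n v n + / 4 * sum_n u n).
{ induction n as [|n IHn].
  - rewrite sum_Sn, odd, !sum_O; apply Rplus_eq_compat_r, (even 0%nat).
  - rewrite sum_Sn, odd; replace (2 * S n)%nat with (S (S (2 * n))) by lia.
    rewrite (sum_Sn u (S (2 * n))), (sum_Sn v), (sum_Sn u n), IHn.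
    replace (S (S (2 * n))) with (2 * S n)%nat by lia; rewrite even.
    unfold plus; simpl; ring. }
assert (incr : forall n, sum_n u n <= sum_n u (S n)).
{ intros n; rewrite sum_Sn; unfold plus; simpl; specialize (u0 (S n)); lra. }
assert (mono : forall n m, (n <= m)%nat -> sum_n u n <= sum_n u m).
{ intros n m; induction 1; [lra | specialize (incr m); lra]. }
assert (Hv : is_lim_seq (sum_n v) (PI ^ 2 / 8)) by exact is_series_inv_sqr_odd.
assert (v_le : forall n, sum_n v n <= PI ^ 2 / 8).
{ apply is_lim_seq_incr_compare; [exact Hv|].
  intros n; rewrite sum_Sn; unfold plus; simpl.
  specialize (u0 (2 * S n)%nat); rewrite even in u0; lra. }
assert (Hex : ex_finite_lim_seq (sum_n u)).
{ apply ex_finite_lim_seq_incr with (PI ^ 2 / 6); [exact incr|].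
  intros n; assert (H := mono n (S (2 * n)) ltac:(lia)); specialize (v_le n).
  rewrite split in H; lra. }
destruct Hex as [l Hl].
assert (H1 : is_lim_seq (fun n => sum_n u (S (2 * n))) l).
{ apply (is_lim_seq_subseq (sum_n u)); [|exact Hl].
  intros P [N HN]; exists N; intros n Hn; apply HN; lia. }
assert (H2 : is_lim_seq (fun n => sum_n u (S (2 * n))) (PI ^ 2 / 8 + / 4 * l)).
{ apply is_lim_seq_ext with (fun n => sum_n v n + / 4 * sum_n u n); [easy|].
  apply is_lim_seq_plus'; [exact Hv|].
  apply is_lim_seq_mult'; [apply is_lim_seq_const | exact Hl]. }
apply is_lim_seq_unique in H1; apply is_lim_seq_unique in H2.
assert (E : PI ^ 2 / 8 + / 4 * l = l) by congruence.
replace (PI ^ 2 / 6) with l by lra; exact Hl.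
Qed.

(** * Gauss's limit for the digamma function *)

Definition digamma_approx (n : nat) (x : R) : R :=
  ln (INR n) - sum_n (fun j => / (x + INR j)) n.

(** At a pole the singular term is / 0 = 0, so the limit exists there too. In particular the value
    at 0 is minus the Euler constant. *)
Definition digammaR (x : R) : R := real (Lim_seq (fun n => digamma_approx n x)).

Lemma digamma_approx_S (n : nat) (x : R) :
  digamma_approx (S n) x =
  digamma_approx n x + (ln (INR (S n)) - ln (INR n) - / (x + INR (S n))).
Proof. unfold digamma_approx; rewrite sum_Sn; unfold plus; simpl; ring. Qed.

(** A Cauchy estimate with an explicit rate passes to the limit in [n] with [m] fixed. It serves
    both for [digamma_approx] and for the logarithm of the tail of Euler's product. *)
Lemma is_lim_seq_rate (u : nat -> R) (K : R) (N : nat) : (0 < N)%nat ->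
  (forall m n, (N <= m <= n)%nat -> Rabs (u n - u m) <= K / INR m) ->
  is_lim_seq u (real (Lim_seq u)) /\
  forall m, (N <= m)%nat -> Rabs (real (Lim_seq u) - u m) <= K / INR m.
Proof.
intros N0 Hu.
assert (Hpos : forall m, (N <= m)%nat -> 0 < INR m) by (intros m Hm; apply lt_0_INR; lia).
assert (K0 : 0 <= K).
{ specialize (Hu N N ltac:(lia)); specialize (Hpos N ltac:(lia)).
  replace K with (K / INR N * INR N) by (field; lra).
  apply Rmult_le_pos; [|lra]; apply Rle_trans with (2 := Hu), Rabs_pos. }
assert (Hlim : is_lim_seq u (real (Lim_seq u))).
{ apply Lim_seq_correct', ex_lim_seq_cauchy_corr; intros eps.
  (* [K + 1] instead of [K], which may be 0. *)
  destruct (archimed_cor1 (eps / (K + 1))) as [m0 [Hm0 m0pos]].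
  { apply Rdiv_lt_0_compat; [apply cond_pos | lra]. }
  assert (Hm : forall m, (max N m0 <= m)%nat -> K / INR m < eps).
  { intros m Hm; assert (Hmpos := Hpos m ltac:(lia)).
    assert (/ INR m <= / INR m0)
      by (apply Rinv_le_contravar; [apply lt_0_INR; lia | apply le_INR; lia]).
    apply Rle_lt_trans with ((K + 1) * / INR m);
      [assert (0 < / INR m) by (apply Rinv_0_lt_compat; lra); unfold Rdiv; nra|].
    apply Rle_lt_trans with ((K + 1) * / INR m0); [apply Rmult_le_compat_l; lra|].
    apply Rlt_le_trans with ((K + 1) * (eps / (K + 1))); [apply Rmult_lt_compat_l; lra|].
    right; field; lra. }
  exists (max N m0); intros n m Hn Hm'.
  destruct (Nat.le_ge_cases m n).
  - apply Rle_lt_trans with (K / INR m); [apply Hu; lia | apply Hm; lia].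
  - rewrite Rabs_minus_sym; apply Rle_lt_trans with (K / INR n); [apply Hu; lia | apply Hm; lia]. }
split; [exact Hlim|]; intros m Hm.
apply (is_lim_seq_le_loc (fun n => Rabs (u n - u m)) (fun _ => K / INR m)
         (Finite (Rabs (real (Lim_seq u) - u m))) (Finite (K / INR m))).
- exists m; intros n Hn; apply Hu; lia.
- apply (is_lim_seq_abs _ (Finite _)), is_lim_seq_minus'; [exact Hlim | apply is_lim_seq_const].
- apply is_lim_seq_const.
Qed.

Lemma ln_le_minus_one (y : R) : 0 < y -> ln y <= y - 1.
Proof. intros Hy; assert (H := exp_ineq1_le (ln y)); rewrite exp_ln in H; lra. Qed.

Lemma ln_succ_bounds (x : R) : 0 < x -> / (x + 1) <= ln (x + 1) - ln x <= / x.
Proof.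
intros Hx; split.
- assert (H := ln_le_minus_one (x / (x + 1)) ltac:(apply Rdiv_lt_0_compat; lra)).
  rewrite ln_div in H by lra.
  replace (x / (x + 1) - 1) with (- / (x + 1)) in H by (field; lra); lra.
- assert (H := ln_le_minus_one ((x + 1) / x) ltac:(apply Rdiv_lt_0_compat; lra)).
  rewrite ln_div in H by lra.
  replace ((x + 1) / x - 1) with (/ x) in H by (field; lra); lra.
Qed.

(** The right side is written so as to telescope. Replacing ln(j + 1) - ln j by 1 / (j + 1) costs
    one difference 1 / j - 1 / (j + 1). Shifting the denominator by [x] costs 2M of them, because x
    + j + 1 is at least j / 2. *)
Lemma digamma_step_bound (M x : R) (j : nat) :
  Rabs x <= M -> 2 * M + 1 <= INR j ->
  Rabs (ln (INR (S j)) - ln (INR j) - / (x + INR (S j)))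
  <= (2 * M + 1) * (/ INR j - / INR (S j)).
Proof.
intros Hx Hj; apply Rabs_le_between in Hx; rewrite S_INR; set (y := INR j) in *.
assert (Hln := ln_succ_bounds y ltac:(lra)).
assert (Hd : Rabs (/ (y + 1) - / (x + (y + 1))) <= 2 * M * (/ y - / (y + 1))).
{ replace (/ (y + 1) - / (x + (y + 1))) with (x * / ((y + 1) * (x + y + 1)))
    by (field; lra).
  replace (2 * M * (/ y - / (y + 1))) with (M * (2 * / (y * (y + 1)))) by (field; lra).
  assert (Hxy : 0 < (y + 1) * (x + y + 1)) by nra.
  rewrite Rabs_mult, (Rabs_pos_eq (/ _)) by (apply Rlt_le, Rinv_0_lt_compat, Hxy).
  apply Rmult_le_compat; [apply Rabs_pos | apply Rlt_le, Rinv_0_lt_compat, Hxy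
    | apply Rabs_le_between; lra |].
  apply (Rmult_le_reg_r ((y + 1) * (x + y + 1) * y)); [nra|].
  field_simplify; nra. }
replace (ln (y + 1) - ln y - / (x + (y + 1)))
  with ((ln (y + 1) - ln y - / (y + 1)) + (/ (y + 1) - / (x + (y + 1)))) by ring.
apply Rle_trans with (1 := Rabs_triang _ _).
rewrite (Rabs_pos_eq (_ - / (y + 1))) by lra; lra.
Qed.

Lemma digamma_approx_dist (M x : R) (m n : nat) :
  Rabs x <= M -> 2 * M + 1 <= INR m -> (m <= n)%nat ->
  Rabs (digamma_approx n x - digamma_approx m x) <= (2 * M + 1) / INR m.
Proof.
intros Hx Hm Hn.
assert (HM : 0 <= M) by (apply Rle_trans with (2 := Hx), Rabs_pos).
apply Rle_trans with ((2 * M + 1) * (/ INR m - / INR n)).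
- induction Hn as [|n Hn IHn].
  + rewrite !Rminus_diag, Rabs_R0; lra.
  + rewrite digamma_approx_S.
    assert (Hmn := le_INR _ _ Hn).
    assert (H := digamma_step_bound M x n Hx ltac:(lra)).
    set (s := _ - _ - _) in *.
    replace (digamma_approx n x + s - digamma_approx m x)
      with ((digamma_approx n x - digamma_approx m x) + s) by ring.
    apply Rle_trans with (1 := Rabs_triang _ _); lra.
- apply Rmult_le_compat_l; [lra|].
  assert (0 < / INR n) by (apply Rinv_0_lt_compat; assert (H := le_INR _ _ Hn); lra); lra.
Qed.

Lemma digammaR_rate (M x : R) (N : nat) : Rabs x <= M -> 2 * M + 1 <= INR N ->
  is_lim_seq (fun n => digamma_approx n x) (digammaR x) /\
  forall m, (N <= m)%nat -> Rabs (digammaR x - digamma_approx m x) <= (2 * M + 1) / INR m.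
Proof.
intros Hx HN; assert (HM : 0 <= M) by (apply Rle_trans with (2 := Hx), Rabs_pos).
apply is_lim_seq_rate.
- apply INR_lt; simpl; lra.
- intros m n [H1 H2]; apply digamma_approx_dist; trivial.
  apply Rle_trans with (1 := HN), le_INR, H1.
Qed.

Lemma nat_above (a : R) : exists n : nat, a <= INR n.
Proof.
destruct (INR_unbounded a) as [n Hn]; exists n; lra.
Qed.

Lemma digammaR_lim (x : R) : is_lim_seq (fun n => digamma_approx n x) (digammaR x).
Proof.
destruct (nat_above (2 * Rabs x + 1)) as [N HN].
exact (proj1 (digammaR_rate (Rabs x) x N (Rle_refl _) HN)).
Qed.

(** The logarithm of [gamma_approx (N + i) y / gamma_approx N y], meaningful for y + N > 0: only
    factors past index [N] occur, and these are positive even where the gamma function is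
    negative. *)
Fixpoint log_gamma_tail (N i : nat) (y : R) : R :=
  match i with
  | O => 0
  | S i' => log_gamma_tail N i' y
      + (y * (ln (INR (N + i)) - ln (INR (N + i'))) + ln (INR (N + i)) - ln (y + INR (N + i)))
  end.

Lemma is_derive_log_gamma_tail (N i : nat) (y : R) : 0 < y + INR N ->
  is_derive (log_gamma_tail N i) y (digamma_approx (N + i) y - digamma_approx N y).
Proof.
intros Hy; induction i as [|i IHi].
- rewrite Nat.add_0_r, Rminus_diag; apply (is_derive_const 0).
- rewrite Nat.add_succ_r, digamma_approx_S; simpl log_gamma_tail.
  rewrite Nat.add_succ_r.
  assert (H : INR N <= INR (S (N + i))) by (apply le_INR; lia).
  replace (_ - digamma_approx N y) with (plus (digamma_approx (N + i) y - digamma_approx N y)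
    (ln (INR (S (N + i))) - ln (INR (N + i)) - / (y + INR (S (N + i)))))
    by (unfold plus; simpl; ring).
  apply (is_derive_plus (log_gamma_tail N i)); [exact IHi|].
  set (m := INR (S (N + i))) in *; auto_derive; [lra | field; lra].
Qed.

Lemma log_gamma_tail_0 (N i : nat) : log_gamma_tail N i 0 = 0.
Proof.
induction i as [|i IHi]; [reflexivity|].
simpl log_gamma_tail; rewrite IHi, !Rplus_0_l; ring.
Qed.

(** Mean value theorem between 0, where all tails vanish, and [y]: the derivative of the difference
    is a difference of [digamma_approx], already bounded uniformly for |t| <= M. *)
Lemma log_gamma_tail_dist (M : R) (N i j : nat) (y : R) :
  Rabs y <= M -> 2 * M + 1 <= INR N -> (i <= j)%nat ->
  Rabs (log_gamma_tail N j y - log_gamma_tail N i y) <= M * (2 * M + 1) / INR (N + i).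
Proof.
intros Hy HN Hij; assert (HM : 0 <= M) by (apply Rle_trans with (2 := Hy), Rabs_pos).
assert (Hi : INR N <= INR (N + i)) by (apply le_INR; lia).
assert (Hd : forall t, Rabs t <= M ->
  is_derive (fun t => log_gamma_tail N j t - log_gamma_tail N i t) t
    (digamma_approx (N + j) t - digamma_approx (N + i) t)).
{ intros t Ht; apply Rabs_le_between in Ht.
  replace (digamma_approx (N + j) t - digamma_approx (N + i) t)
    with (minus (digamma_approx (N + j) t - digamma_approx N t)
      (digamma_approx (N + i) t - digamma_approx N t))
    by (unfold minus, plus, opp; simpl; ring).
  apply (is_derive_minus (log_gamma_tail N j)); apply is_derive_log_gamma_tail; lra. }
assert (Ht : forall t, Rmin 0 y <= t <= Rmax 0 y -> Rabs t <= M).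
{ intros t; apply Rabs_le_between in Hy; unfold Rmin, Rmax; destruct Rle_dec;
    intros; apply Rabs_le_between; lra. }
destruct (MVT_gen (fun t => log_gamma_tail N j t - log_gamma_tail N i t) 0 y
  (fun t => digamma_approx (N + j) t - digamma_approx (N + i) t)) as [c [Hc E]].
- intros t Htr; apply Hd, Ht; lra.
- intros t Htr; apply continuity_pt_filterlim.
  apply (ex_derive_continuous (fun t => log_gamma_tail N j t - log_gamma_tail N i t)).
  eexists; apply Hd, Ht, Htr.
- rewrite !log_gamma_tail_0, !Rminus_0_r in E; rewrite E, Rabs_mult.
  replace (M * (2 * M + 1) / INR (N + i)) with ((2 * M + 1) / INR (N + i) * M) by (field; lra).
  apply Rmult_le_compat; try apply Rabs_pos; [|exact Hy].
  apply digamma_approx_dist; [apply Ht, Hc | lra | lia].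
Qed.

Definition log_gamma_tail_lim (N : nat) (y : R) : R :=
  real (Lim_seq (fun i => log_gamma_tail N i y)).

Lemma log_gamma_tail_limit (M : R) (N : nat) (y : R) :
  Rabs y <= M -> 2 * M + 1 <= INR N ->
  is_lim_seq (fun i => log_gamma_tail N i y) (log_gamma_tail_lim N y).
Proof.
intros Hy HN; assert (HM : 0 <= M) by (apply Rle_trans with (2 := Hy), Rabs_pos).
apply (is_lim_seq_rate _ (M * (2 * M + 1)) 1); [lia|].
intros i j [Hi Hij]; apply Rle_trans with (1 := log_gamma_tail_dist M N i j y Hy HN Hij).
apply Rmult_le_compat_l; [apply Rmult_le_pos; lra|].
apply Rinv_le_contravar; [apply lt_0_INR; lia | apply le_INR; lia].
Qed.

Lemma digamma_approx_continuity (n : nat) (x : R) :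
  (forall j, (j <= n)%nat -> x + INR j <> 0) -> continuity_pt (digamma_approx n) x.
Proof.
intros Hx; apply continuity_pt_filterlim.
apply (continuous_minus (fun _ => ln (INR n))); [apply continuous_const|].
induction n as [|n IHn].
- apply (continuous_ext (fun x => / (x + INR 0))).
  + intros t; rewrite sum_O; reflexivity.
  + apply (ex_derive_continuous (fun x => / (x + INR 0))); auto_derive.
    apply (Hx 0%nat); lia.
- apply (continuous_ext (fun x => plus (sum_n (fun j => / (x + INR j)) n) (/ (x + INR (S n))))).
  + intros t; rewrite sum_Sn; reflexivity.
  + apply (continuous_plus (fun x => sum_n (fun j => / (x + INR j)) n)).
    * apply IHn; intros j Hj; apply Hx; lia.
    * apply (ex_derive_continuous (fun x => / (x + INR (S n)))); auto_derive.
      apply (Hx (S n)); lia.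
Qed.

Lemma digamma_tail_CVU (M : posreal) (N : nat) : 2 * M + 1 <= INR N ->
  CVU (fun i y => digamma_approx (N + i) y - digamma_approx N y)
      (fun y => digammaR y - digamma_approx N y) 0 M.
Proof.
intros HN eps Heps; assert (HM := cond_pos M).
destruct (nat_above ((2 * M + 1) / eps + 1)) as [i0 Hi0].
exists i0; intros i y Hi Hy; unfold Boule in Hy; rewrite Rminus_0_r in Hy.
replace (digammaR y - digamma_approx N y - _)
  with (digammaR y - digamma_approx (N + i) y) by ring.
apply Rle_lt_trans with (1 := proj2 (digammaR_rate M y N (Rlt_le _ _ Hy) HN) (N + i)%nat ltac:(lia)).
assert (H : INR i0 <= INR (N + i)) by (apply le_INR; lia).
assert (0 < (2 * M + 1) / eps) by (apply Rdiv_lt_0_compat; lra).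
apply (Rmult_lt_reg_r (INR (N + i))); [lra|].
replace ((2 * M + 1) / INR (N + i) * INR (N + i)) with ((2 * M + 1) / eps * eps)
  by (field; lra).
rewrite (Rmult_comm eps); apply Rmult_lt_compat_r; lra.
Qed.

(** The terms singular inside the ball cancel in the difference, so it is a uniform limit of
    continuous functions even across the poles. *)
Lemma digamma_tail_continuity (M : posreal) (N : nat) (y : R) :
  2 * M + 1 <= INR N -> Boule 0 M y ->
  continuity_pt (fun y => digammaR y - digamma_approx N y) y.
Proof.
intros HN; revert y; apply (CVU_continuity _ _ _ _ (digamma_tail_CVU M N HN)).
intros i y Hy; assert (HM := cond_pos M).
unfold Boule in Hy; rewrite Rminus_0_r in Hy; apply Rabs_lt_between in Hy.
induction i as [|i IHi].
- rewrite Nat.add_0_r; apply continuity_pt_ext with (fun _ => 0).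
  + intros t; ring.
  + apply continuity_pt_const; intros ? ?; reflexivity.
- rewrite Nat.add_succ_r.
  apply continuity_pt_ext with (fun y => (digamma_approx (N + i) y - digamma_approx N y) +
    (ln (INR (S (N + i))) - ln (INR (N + i)) - / (y + INR (S (N + i))))).
  + intros t; rewrite digamma_approx_S; ring.
  + apply (continuity_pt_plus (fun y => digamma_approx (N + i) y - digamma_approx N y)).
    * exact IHi.
    * assert (H : INR N <= INR (S (N + i))) by (apply le_INR; lia).
      set (m := INR (S (N + i))) in *; set (c := _ - _).
      apply continuity_pt_filterlim, (ex_derive_continuous (fun y => c - / (y + m))).
      auto_derive; lra.
Qed.

(** The tails converge pointwise and their derivatives uniformly to a continuous limit, so limit and
    derivative may be exchanged. *)
Lemma is_derive_log_gamma_tail_lim (M : posreal) (N : nat) (y : R) :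
  2 * M + 1 <= INR N -> Boule 0 M y ->
  is_derive (log_gamma_tail_lim N) y (digammaR y - digamma_approx N y).
Proof.
intros HN Hy; apply is_derive_Reals; assert (HM := cond_pos M).
apply (CVU_derivable (log_gamma_tail N)
  (fun i y => digamma_approx (N + i) y - digamma_approx N y) _
  (fun y => digammaR y - digamma_approx N y) 0 M (digamma_tail_CVU M N HN)); [| |exact Hy].
- intros t Ht; unfold Boule in Ht; rewrite Rminus_0_r in Ht.
  apply is_lim_seq_Reals, (log_gamma_tail_limit M); [lra | exact HN].
- intros i t Ht; unfold Boule in Ht; rewrite Rminus_0_r in Ht; apply Rabs_lt_between in Ht.
  apply is_derive_Reals, is_derive_log_gamma_tail; lra.
Qed.

Lemma digammaR_continuity (x : R) : (forall j, x + INR j <> 0) -> continuity_pt digammaR x.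
Proof.
intros Hx; assert (HM : 0 < Rabs x + 1) by (assert (H := Rabs_pos x); lra).
destruct (nat_above (2 * (Rabs x + 1) + 1)) as [N HN].
apply continuity_pt_ext with
  (fun y => digamma_approx N y + (digammaR y - digamma_approx N y)).
{ intros t; ring. }
apply (continuity_pt_plus (digamma_approx N)).
- apply digamma_approx_continuity; intros j _; apply Hx.
- apply (digamma_tail_continuity (mkposreal _ HM)); [exact HN|].
  unfold Boule; rewrite Rminus_0_r; simpl; lra.
Qed.

(** * The logarithmic derivative of Euler's product on the real line *)

Fixpoint rising (x : R) (n : nat) : R :=
  match n with
  | O => x
  | S m => rising x m * (x + INR n)
  end.

Definition gamma_approx (n : nat) (x : R) : R :=
  INR (fact n) * exp (x * ln (INR n)) / rising x n.

Definition gammaR (x : R) : R := real (Lim_seq (fun n => gamma_approx n x)).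

Lemma rising_neq_0 (x : R) (n : nat) : (forall j, x + INR j <> 0) -> rising x n <> 0.
Proof.
intros Hx; induction n as [|n IHn].
- rewrite <- (Rplus_0_r x); apply (Hx 0%nat).
- apply Rmult_integral_contrapositive_currified; [exact IHn | apply Hx].
Qed.

Lemma is_derive_rising (x : R) (n : nat) : (forall j, x + INR j <> 0) ->
  is_derive (fun x => rising x n) x (rising x n * sum_n (fun j => / (x + INR j)) n).
Proof.
intros Hx; induction n as [|n IHn].
- rewrite sum_O; simpl; assert (H := Hx 0%nat); simpl in H; rewrite Rplus_0_r in *.
  rewrite Rinv_r by exact H; apply (is_derive_id x).
- rewrite sum_Sn; unfold plus; cbn [rising AbelianMonoid.plus].
  set (m := INR (S n)); assert (Hm : x + m <> 0) by apply Hx.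
  set (s := sum_n _ n) in *.
  evar_last.
  + apply (is_derive_mult (fun x => rising x n) (fun x => x + m) x _ 1 IHn).
    * auto_derive; [trivial | reflexivity].
    * intros; apply Rmult_comm.
  + unfold plus, mult; simpl; fold m; field; exact Hm.
Qed.

Lemma is_derive_gamma_approx (x : R) (n : nat) : (forall j, x + INR j <> 0) ->
  is_derive (gamma_approx n) x (gamma_approx n x * digamma_approx n x).
Proof.
intros Hx; unfold gamma_approx, digamma_approx.
assert (Hr := rising_neq_0 x n Hx).
evar_last.
- apply (is_derive_div (fun x => INR (fact n) * exp (x * ln (INR n))) (fun x => rising x n) x
    (INR (fact n) * exp (x * ln (INR n)) * ln (INR n))
    (rising x n * sum_n (fun j => / (x + INR j)) n)); [|apply is_derive_rising, Hx | exact Hr].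
  auto_derive; [trivial | ring].
- simpl; field; exact Hr.
Qed.

Lemma gamma_approx_tail (N i : nat) (y : R) : (0 < N)%nat -> 0 < y + INR N ->
  gamma_approx (N + i) y = gamma_approx N y * exp (log_gamma_tail N i y).
Proof.
intros N0 Hy; induction i as [|i IHi].
- rewrite Nat.add_0_r; simpl; rewrite exp_0; ring.
- rewrite Nat.add_succ_r; simpl log_gamma_tail; rewrite exp_plus, <- Rmult_assoc, <- IHi.
  rewrite Nat.add_succ_r; unfold gamma_approx.
  assert (H : INR N <= INR (S (N + i))) by (apply le_INR; lia).
  assert (Hp : 0 < INR N) by (apply lt_0_INR; exact N0).
  rewrite fact_simpl, mult_INR; cbn [rising]; set (m := INR (S (N + i))) in *.
  set (l := ln (INR (N + i))).
  replace (y * (ln m - l) + ln m - ln (y + m))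
    with (y * ln m + - (y * l) + ln m + - ln (y + m)) by ring.
  rewrite !exp_plus, !exp_Ropp, !exp_ln by lra.
  assert (H1 := exp_pos (y * l)); unfold Rdiv; rewrite Rinv_mult.
  set (r := / rising y (N + i)); field; lra.
Qed.

Lemma gammaR_tail (M : posreal) (N : nat) (y : R) : 2 * M + 1 <= INR N -> Boule 0 M y ->
  is_lim_seq (fun n => gamma_approx n y) (gamma_approx N y * exp (log_gamma_tail_lim N y)).
Proof.
intros HN Hy; assert (HM := cond_pos M).
unfold Boule in Hy; rewrite Rminus_0_r in Hy.
assert (Hy' := Hy); apply Rabs_lt_between in Hy'.
apply (is_lim_seq_incr_n _ N), is_lim_seq_ext with
  (fun i => gamma_approx N y * exp (log_gamma_tail N i y)).
- intros i; rewrite Nat.add_comm, gamma_approx_tail; [reflexivity| |lra].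
  apply INR_lt; simpl; lra.
- apply is_lim_seq_mult'; [apply is_lim_seq_const|].
  apply (is_lim_seq_continuous exp _ (log_gamma_tail_lim N y)).
  + apply derivable_continuous_pt, derivable_pt_exp.
  + apply (log_gamma_tail_limit M); [lra | exact HN].
Qed.

(** Near [x], [gammaR] is the nonzero factor [gamma_approx N] times an exponential. The logarithmic
    derivatives of the two add up to [digamma_approx N x + (digammaR x - digamma_approx N x)]. *)
Lemma is_derive_gammaR (x : R) : (forall j, x + INR j <> 0) ->
  gammaR x <> 0 /\ is_derive gammaR x (gammaR x * digammaR x).
Proof.
intros Hx; assert (HM : 0 < Rabs x + 1) by (assert (H := Rabs_pos x); lra).
destruct (nat_above (2 * (Rabs x + 1) + 1)) as [N HN].
set (M := mkposreal _ HM).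
assert (HxM : Boule 0 M x) by (unfold Boule; rewrite Rminus_0_r; simpl; lra).
assert (E : forall y, Boule 0 M y ->
  gammaR y = gamma_approx N y * exp (log_gamma_tail_lim N y)).
{ intros y Hy; unfold gammaR; rewrite (is_lim_seq_unique _ _ (gammaR_tail M N y HN Hy)).
  reflexivity. }
rewrite (E x HxM); split.
- apply Rmult_integral_contrapositive_currified; [|apply Rgt_not_eq, exp_pos].
  apply Rmult_integral_contrapositive_currified;
    [|apply Rinv_neq_0_compat, rising_neq_0, Hx].
  apply Rmult_integral_contrapositive_currified;
    [apply not_0_INR, fact_neq_0 | apply Rgt_not_eq, exp_pos].
- apply is_derive_ext_loc with
    (fun y => gamma_approx N y * exp (log_gamma_tail_lim N y)).
  { exists (mkposreal 1 Rlt_0_1); intros y Hy; symmetry; apply E.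
    unfold ball in Hy; simpl in Hy; unfold AbsRing_ball, abs, minus, plus, opp in Hy; simpl in Hy.
    unfold Boule; rewrite Rminus_0_r; simpl.
    replace y with ((y + - x) + x) by ring.
    apply Rle_lt_trans with (1 := Rabs_triang _ _); lra. }
  evar_last.
  + apply (is_derive_mult (gamma_approx N) (fun y => exp (log_gamma_tail_lim N y)) x).
    * apply is_derive_gamma_approx, Hx.
    * apply (is_derive_comp exp).
      -- apply is_derive_exp.
      -- apply (is_derive_log_gamma_tail_lim M N x HN HxM).
    * intros; apply Rmult_comm.
  + unfold plus, mult, scal; simpl; unfold mult; simpl; ring.
Qed.

(** * From the complex definitions to the real functions *)

Lemma RtoC_div_total (x y : R) : RtoC (x / y) = (RtoC x / RtoC y)%C.
Proof.
destruct (Req_dec y 0) as [->|Hy]; [|apply RtoC_div, Hy].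
unfold Rdiv, Cdiv; rewrite Rinv_0; unfold Cinv, Cmult, RtoC; simpl; f_equal; unfold Rdiv; ring.
Qed.

Lemma Crising_RtoC (x : R) (n : nat) : Crising (RtoC x) n = RtoC (rising x n).
Proof.
induction n as [|n IHn]; [reflexivity|].
cbn [Crising rising]; rewrite IHn, RtoC_mult, RtoC_plus; reflexivity.
Qed.

Lemma Gamma_seq_RtoC (x : R) (n : nat) : Gamma_seq (RtoC x) n = RtoC (gamma_approx n x).
Proof.
unfold Gamma_seq, gamma_approx; rewrite RtoC_div_total, RtoC_mult, Crising_RtoC.
do 2 f_equal; rewrite <- RtoC_mult; unfold Cexp, RtoC; simpl.
rewrite cos_0, sin_0; f_equal; ring.
Qed.

Lemma Gamma_RtoC (x : R) : Gamma (RtoC x) = RtoC (gammaR x).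
Proof.
unfold Gamma, gammaR; unfold RtoC at 3; f_equal.
- f_equal; apply Lim_seq_ext; intros n; rewrite Gamma_seq_RtoC; reflexivity.
- transitivity (real (Lim_seq (fun _ => 0))); [|rewrite Lim_seq_const; reflexivity].
  f_equal; apply Lim_seq_ext; intros n; rewrite Gamma_seq_RtoC; reflexivity.
Qed.

(* [C_derive] takes the limit of the difference quotient along the horizontal
   line through the point, here the real axis. *)
Lemma digamma_RtoC (x : R) : (forall j, x + INR j <> 0) ->
  digamma (RtoC x) = RtoC (digammaR x).
Proof.
intros Hx; destruct (is_derive_gammaR x Hx) as [g0 dg].
assert (E : C_derive Gamma (RtoC x) = RtoC (gammaR x * digammaR x)).
{ assert (quot : forall t, ((Gamma (t, snd (RtoC x)) - Gamma (RtoC x)) / ((t, snd (RtoC x)) - RtoC x))%C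
    = RtoC ((gammaR t - gammaR x) / (t - x))).
  { intros t; change (t, snd (RtoC x)) with (RtoC t).
    rewrite !Gamma_RtoC, <- !RtoC_minus, RtoC_div_total; reflexivity. }
  unfold C_derive, C_lim; change (RtoC (gammaR x * digammaR x)) with (gammaR x * digammaR x, 0); f_equal.
  - rewrite (Lim_ext (fun t => (gammaR t - gammaR x) / (t - x)));
      [|intros t; rewrite quot; reflexivity].
    rewrite (is_lim_unique _ _ (gammaR x * digammaR x)); [reflexivity|].
    apply is_lim_spec; intros eps.
    apply is_derive_Reals in dg; destruct (dg eps (cond_pos eps)) as [d Hd].
    exists d; intros t Ht Htx.
    unfold ball in Ht; simpl in Ht; unfold AbsRing_ball, abs, minus, plus, opp in Ht; simpl in Ht.
    simpl in Htx; specialize (Hd (t - x) (Rminus_eq_contra _ _ Htx) Ht).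
    rewrite Rplus_minus in Hd; exact Hd.
  - rewrite (Lim_ext (fun _ => 0)); [|intros t; rewrite quot; reflexivity].
    rewrite Lim_const; reflexivity. }
unfold digamma; rewrite E, Gamma_RtoC, <- RtoC_div by exact g0.
f_equal; field; exact g0.
Qed.

Lemma digamma_zero_RtoC (x : R) :
  digamma_zero (RtoC x) <-> (forall j, x + INR j <> 0) /\ digammaR x = 0.
Proof.
assert (pole : ~ nonpos_integer (RtoC x) <-> (forall j, x + INR j <> 0)).
{ split.
  - intros H j Hj; apply H; exists j; f_equal; lra.
  - intros H [j Hj]; apply (H j); injection Hj; lra. }
unfold digamma_zero; rewrite pole; split; intros [Hx H0]; split; trivial.
- rewrite (digamma_RtoC x Hx) in H0; injection H0; trivial.
- rewrite (digamma_RtoC x Hx), H0; reflexivity.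
Qed.

(** * Location of the zeros *)

(* The components of R minus the poles: (-k, 1 - k) for k >= 1, (0, oo) for k = 0. *)
Definition gap (k : nat) (x : R) : Prop := - INR k < x /\ (k = 0%nat \/ x < 1 - INR k).

Lemma gap_lt (i j : nat) (x y : R) : gap i x -> gap j y -> (i < j)%nat -> y < x.
Proof.
intros [Hi _] [_ Hj] Hij; assert (H := le_INR (S i) j Hij); rewrite S_INR in H.
destruct Hj as [->|Hj]; [lia | lra].
Qed.

Lemma gap_inj (i j : nat) (x : R) : gap i x -> gap j x -> i = j.
Proof.
intros Hi Hj; destruct (Nat.lt_trichotomy i j) as [H|[H|H]]; trivial.
- assert (H' := gap_lt i j x x Hi Hj H); lra.
- assert (H' := gap_lt j i x x Hj Hi H); lra.
Qed.

Lemma gap_cover (x : R) : (forall j, x + INR j <> 0) -> exists k, gap k x.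
Proof.
intros Hx.
assert (H : forall n, - INR n < x -> exists k, gap k x).
{ induction n as [|n IHn]; intros Hn.
  - exists 0%nat; split; auto.
  - destruct (Rlt_le_dec (- INR n) x) as [H|H]; [exact (IHn H)|].
    exists (S n); split; [exact Hn | right; rewrite S_INR].
    assert (Hxn := Hx n); destruct H as [H|H]; [lra | elim Hxn; lra]. }
destruct (INR_unbounded (- x)) as [n Hn]; apply (H n); lra.
Qed.

(** No pole separates two points of the same gap. This makes every term of [digamma_approx] monotone
    on a gap. *)
Lemma gap_mul_pos (k j : nat) (x y : R) : gap k x -> gap k y -> 0 < (x + INR j) * (y + INR j).
Proof.
intros [Hx Hx'] [Hy Hy']; destruct (Nat.le_gt_cases k j) as [H|H].
- apply le_INR in H; apply Rmult_lt_0_compat; lra.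
- assert (H' := le_INR (S j) k H); rewrite S_INR in H'.
  destruct Hx' as [->|Hx']; [lia|]; destruct Hy' as [->|Hy']; [lia|].
  replace ((x + INR j) * (y + INR j)) with (- (x + INR j) * - (y + INR j)) by ring.
  apply Rmult_lt_0_compat; lra.
Qed.

Lemma gap_not_pole (k j : nat) (x : R) : gap k x -> x + INR j <> 0.
Proof. intros Hx E; assert (H := gap_mul_pos k j x x Hx Hx); rewrite E in H; lra. Qed.

Lemma gap_convex (k : nat) (x y z : R) : gap k x -> gap k y -> x <= z <= y -> gap k z.
Proof. intros [Hx _] [_ Hy] Hz; split; [lra|]; destruct Hy; [left | right]; trivial; lra. Qed.

Lemma gap_open (k : nat) (x eps : R) : gap k x -> 0 < eps ->
  exists d, 0 < d <= eps /\ gap k (x - d) /\ gap k (x + d).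
Proof.
intros [H1 H2] Heps; destruct H2 as [->|H2].
- simpl in H1.
  assert (A := Rmin_l eps (x / 2)); assert (B := Rmin_r eps (x / 2)).
  assert (0 < Rmin eps (x / 2)) by (apply Rmin_glb_lt; lra).
  exists (Rmin eps (x / 2)); repeat split; simpl; auto; lra.
- set (m := Rmin (x + INR k) (1 - INR k - x)).
  assert (A := Rmin_l (x + INR k) (1 - INR k - x)); fold m in A.
  assert (B := Rmin_r (x + INR k) (1 - INR k - x)); fold m in B.
  assert (0 < m) by (apply Rmin_glb_lt; lra).
  assert (C := Rmin_l eps (m / 2)); assert (D := Rmin_r eps (m / 2)).
  assert (0 < Rmin eps (m / 2)) by (apply Rmin_glb_lt; lra).
  exists (Rmin eps (m / 2)); repeat split; solve [lra | right; lra].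
Qed.

(** The lower bound is the contribution of j = 0 alone, all others being nonnegative. It does not
    depend on [n], so strict monotonicity survives in the limit. *)
Lemma digamma_approx_gap_incr (n k : nat) (x y : R) : gap k x -> gap k y -> x < y ->
  (y - x) / (x * y) <= digamma_approx n y - digamma_approx n x.
Proof.
intros Hx Hy Hxy; unfold digamma_approx.
replace (_ - _ - _) with (sum_n (fun j => / (x + INR j)) n - sum_n (fun j => / (y + INR j)) n) by ring.
assert (term : forall j, / (x + INR j) - / (y + INR j) = (y - x) / ((x + INR j) * (y + INR j))).
{ intros j; field; split; eapply gap_not_pole; eassumption. }
induction n as [|n IHn].
- rewrite !sum_O, term; simpl; rewrite !Rplus_0_r; lra.
- rewrite !sum_Sn; unfold plus; simpl AbelianMonoid.plus; cbn.
  assert (0 <= / (x + INR (S n)) - / (y + INR (S n))).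
  { rewrite term; apply Rlt_le, Rdiv_lt_0_compat; [lra | apply (gap_mul_pos k); trivial]. }
  cbn in *; lra.
Qed.

Lemma gap_div_pos (k : nat) (x y : R) : gap k x -> gap k y -> x < y -> 0 < (y - x) / (x * y).
Proof.
intros Hx Hy Hxy; apply Rdiv_lt_0_compat; [lra|].
assert (H := gap_mul_pos k 0 x y Hx Hy); simpl in H; rewrite !Rplus_0_r in H; exact H.
Qed.

Lemma digamma_approx_gap_lt (n k : nat) (x y : R) : gap k x -> gap k y -> x < y ->
  digamma_approx n x < digamma_approx n y.
Proof.
intros Hx Hy Hxy; assert (H := digamma_approx_gap_incr n k x y Hx Hy Hxy).
assert (H' := gap_div_pos k x y Hx Hy Hxy); lra.
Qed.

Lemma digammaR_gap_lt (k : nat) (x y : R) : gap k x -> gap k y -> x < y ->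
  digammaR x < digammaR y.
Proof.
intros Hx Hy Hxy; assert (H' := gap_div_pos k x y Hx Hy Hxy).
assert (H := is_lim_seq_le (fun _ => (y - x) / (x * y))
  (fun n => digamma_approx n y - digamma_approx n x) (Finite ((y - x) / (x * y)))
  (Finite (digammaR y - digammaR x))
  (fun n => digamma_approx_gap_incr n k x y Hx Hy Hxy) (is_lim_seq_const _)
  (is_lim_seq_minus' _ _ _ _ (digammaR_lim y) (digammaR_lim x))).
simpl in H; lra.
Qed.

Lemma digammaR_gap_inj (k : nat) (x y : R) : gap k x -> gap k y ->
  digammaR x = digammaR y -> x = y.
Proof.
intros Hx Hy E; destruct (Rtotal_order x y) as [H|[H|H]]; trivial.
- assert (H' := digammaR_gap_lt k x y Hx Hy H); lra.
- assert (H' := digammaR_gap_lt k y x Hy Hx H); lra.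
Qed.

Lemma sum_n_ge_term (u : nat -> R) (c : R) (k n : nat) : 0 <= c -> (k <= n)%nat ->
  (forall j, (j <= n)%nat -> j <> k -> - c <= u j) -> u k - c * INR n <= sum_n u n.
Proof.
intros Hc; assert (all : forall n, (forall j, (j <= n)%nat -> - c <= u j) ->
  - c * INR (S n) <= sum_n u n).
{ induction n0 as [|m IHm]; intros Hu.
  - rewrite sum_O; specialize (Hu 0%nat ltac:(lia)); simpl; lra.
  - rewrite sum_Sn; unfold plus; simpl AbelianMonoid.plus.
    specialize (IHm (fun j Hj => Hu j ltac:(lia))); specialize (Hu (S m) ltac:(lia)).
    rewrite S_INR; cbn -[INR] in *; lra. }
induction n as [|n IHn]; intros Hk Hu.
- replace k with 0%nat by lia; rewrite sum_O; simpl; lra.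
- rewrite sum_Sn; unfold plus; cbn -[INR].
  destruct (Nat.eq_dec k (S n)) as [->|Hne].
  + specialize (all n (fun j Hj => Hu j ltac:(lia) ltac:(lia))).
    cbn -[INR] in *; lra.
  + specialize (IHn ltac:(lia) (fun j Hj => Hu j ltac:(lia))).
    specialize (Hu (S n) ltac:(lia) ltac:(lia)); rewrite S_INR; cbn -[INR] in *; lra.
Qed.

Lemma inv_abs_le_2 (y : R) : (y <= - / 2 \/ / 2 <= y) -> -2 <= / y <= 2.
Proof.
intros H; assert (E : / / 2 = 2) by field; destruct H as [H|H].
- assert (H' : / - y <= / / 2) by (apply Rinv_le_contravar; lra).
  assert (0 < / - y) by (apply Rinv_0_lt_compat; lra).
  rewrite Rinv_opp in *; lra.
- assert (H' : / y <= / / 2) by (apply Rinv_le_contravar; lra).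
  assert (0 < / y) by (apply Rinv_0_lt_compat; lra); lra.
Qed.

Lemma INR_dist (j k : nat) : j <> k -> INR j - INR k <= -1 \/ 1 <= INR j - INR k.
Proof.
intros H; destruct (Nat.lt_gt_cases j k) as [H' _]; destruct (H' H) as [Hl|Hl];
  apply le_INR in Hl; rewrite S_INR in Hl; [left | right]; lra.
Qed.

(** Within 1 / 2 of the pole -k every other denominator is at least 1 / 2 in absolute value, so the
    other n terms contribute at most 2n in absolute value, while the singular one is plus or minus 1
    / d. *)
Lemma digamma_approx_near_pole (n k : nat) (C : R) : (k <= n)%nat ->
  exists d, 0 < d <= / 2 /\
    digamma_approx n (- INR k + d) < - C /\ C < digamma_approx n (- INR k - d).
Proof.
(* With d = 1 / B the singular term outweighs the logarithm, the other terms and [C]; the extra 2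
   gives d <= 1 / 2. *)
intros Hk; set (B := Rabs (ln (INR n)) + Rabs C + 2 * INR n + 2).
assert (H1 := Rabs_pos (ln (INR n))); assert (H2 := Rabs_pos C); assert (H3 := pos_INR n).
assert (HB : 2 <= B) by (unfold B; lra).
assert (H4 := Rle_abs C); assert (H5 := proj1 (Rabs_le_between _ _) (Rle_refl (Rabs (ln (INR n))))).
exists (/ B); assert (Hd : 0 < / B <= / 2).
{ split; [apply Rinv_0_lt_compat; lra | apply Rinv_le_contravar; lra]. }
split; [exact Hd|]; unfold digamma_approx; split.
- assert (H := sum_n_ge_term (fun j => / (- INR k + / B + INR j)) 2 k n ltac:(lra) Hk).
  simpl in H; replace (- INR k + / B + INR k) with (/ B) in H by ring.
  rewrite Rinv_inv in H.
  enough (B - 2 * INR n <= sum_n (fun j => / (- INR k + / B + INR j)) n)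
    by (unfold B in *; lra).
  apply H; intros j _ Hjk; apply inv_abs_le_2.
  destruct (INR_dist j k Hjk); [left | right]; lra.
- assert (H := sum_n_ge_term (fun j => - / (- INR k - / B + INR j)) 2 k n ltac:(lra) Hk).
  simpl in H; replace (- INR k - / B + INR k) with (- / B) in H by ring.
  rewrite Rinv_opp, Rinv_inv in H.
  assert (E : sum_n (fun j => - / (- INR k - / B + INR j)) n =
    - sum_n (fun j => / (- INR k - / B + INR j)) n).
  { rewrite !sum_n_Reals; rewrite <- (Rmult_1_l (sum_f_R0 (fun j => / _) n)), Ropp_mult_distr_l, scal_sum.
    apply sum_eq; intros; ring. }
  rewrite E in H.
  enough (B - 2 * INR n <= - sum_n (fun j => / (- INR k - / B + INR j)) n)
    by (unfold B in *; lra).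
  rewrite Ropp_involutive in H; apply H; intros j _ Hjk.
  assert (Hj : -2 <= / (- INR k - / B + INR j) <= 2); [|lra].
  apply inv_abs_le_2; destruct (INR_dist j k Hjk); [left | right]; lra.
Qed.

Lemma gap_right_of_pole (k : nat) (d : R) : 0 < d <= / 2 -> gap k (- INR k + d).
Proof. intros Hd; split; [lra | right; lra]. Qed.

Lemma gap_left_of_pole (k : nat) (d : R) : 0 < d <= / 2 -> gap (S k) (- INR k - d).
Proof. intros Hd; split; [|right]; rewrite S_INR; lra. Qed.

Lemma gap_IVT (f : R -> R) (k : nat) (p q : R) : gap k p -> gap k q ->
  (forall x, gap k x -> continuity_pt f x) ->
  (forall x y, gap k x -> gap k y -> x < y -> f x < f y) ->
  f p < 0 -> 0 < f q -> exists x, gap k x /\ f x = 0.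
Proof.
intros Hp Hq Hc Hi fp fq.
assert (Hpq : p < q).
{ destruct (Rtotal_order p q) as [H|[->|H]]; [exact H | lra|].
  specialize (Hi q p Hq Hp H); lra. }
destruct (IVT_interv f p q) as [x [Hx fx]]; trivial.
- intros x Hx; apply Hc, (gap_convex k p q); trivial.
- exists x; split; [apply (gap_convex k p q); trivial | exact fx].
Qed.

Lemma digamma_approx_ge (n : nat) (x : R) : 0 < x ->
  ln (INR n) - INR (S n) / x <= digamma_approx n x.
Proof.
intros Hx; unfold digamma_approx.
enough (sum_n (fun j => / (x + INR j)) n <= INR (S n) / x) by lra.
apply Rle_trans with (sum_n (fun _ => / x) n).
- rewrite !sum_n_Reals; apply sum_Rle; intros j _; assert (H := pos_INR j).
  apply Rinv_le_contravar; lra.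
- rewrite sum_n_const; right; reflexivity.
Qed.

Lemma digamma_approx_gap_zero (n k : nat) : (2 <= n)%nat -> (k <= n)%nat ->
  exists x, gap k x /\ digamma_approx n x = 0.
Proof.
intros Hn Hk.
destruct (digamma_approx_near_pole n k 0 Hk) as [d [Hd [Hlo _]]].
assert (Hq : exists q, gap k q /\ 0 < digamma_approx n q).
{ destruct k as [|k].
  - assert (Hln : 0 < ln (INR n)).
    { rewrite <- ln_1; apply ln_increasing; [lra|]; apply (lt_INR 1); lia. }
    assert (HSn : 0 < INR (S n)) by (apply lt_0_INR; lia).
    (* At this point the lower bound ln n - (n + 1) / x equals ln n / 2, positive because n >= 2. *)
    assert (Hx : 0 < 2 * INR (S n) / ln (INR n)) by (apply Rdiv_lt_0_compat; lra).
    exists (2 * INR (S n) / ln (INR n)); split; [split; [simpl (INR 0); lra | auto]|].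
    apply Rlt_le_trans with (2 := digamma_approx_ge n _ Hx).
    replace (INR (S n) / (2 * INR (S n) / ln (INR n))) with (ln (INR n) / 2) by (field; lra).
    lra.
  - destruct (digamma_approx_near_pole n k 0 ltac:(lia)) as [e [He [_ Hhi]]].
    exists (- INR k - e); split; [apply gap_left_of_pole, He | exact Hhi]. }
destruct Hq as [q [Hq Hhi]].
apply (gap_IVT (digamma_approx n) k (- INR k + d) q); trivial.
- apply gap_right_of_pole, Hd.
- intros x Hx; apply digamma_approx_continuity; intros j _; apply (gap_not_pole k j x Hx).
- apply digamma_approx_gap_lt.
- lra.
Qed.

(** An error of 1 is enough: next to a pole [digamma_approx] can be taken beyond 1 or below -1,
    which settles the sign of [digammaR]. *)
Lemma digammaR_near_approx (M : R) : exists N, forall n x, (N <= n)%nat -> Rabs x <= M ->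
  Rabs (digammaR x - digamma_approx n x) <= 1.
Proof.
destruct (nat_above (2 * M + 1)) as [N HN]; exists (max N 1); intros n x Hn Hx.
assert (HM : 0 <= M) by (apply Rle_trans with (2 := Hx), Rabs_pos).
apply Rle_trans with (1 := proj2 (digammaR_rate M x N Hx HN) n ltac:(lia)).
assert (INR N <= INR n) by (apply le_INR; lia).
apply (Rmult_le_reg_r (INR n)); [lra|]; field_simplify; lra.
Qed.

Lemma digammaR_gap_zero (k : nat) : exists x, gap k x /\ digammaR x = 0.
Proof.
destruct (digammaR_near_approx (INR k + 1)) as [N HN].
set (n := max N k); assert (Hk0 := pos_INR k).
destruct (digamma_approx_near_pole n k 1 ltac:(lia)) as [d [Hd [Hlo _]]].
assert (Hp := HN n (- INR k + d) ltac:(lia) ltac:(apply Rabs_le_between; lra)).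
apply Rabs_le_between in Hp.
assert (Hq : exists q, gap k q /\ 0 < digammaR q).
{ destruct k as [|k].
  (* With n = 2X + 1 the approximation error at X is at most 1, and [digamma_approx n X] is at least
     ln(2X + 1) - (2X + 2) / X, which exceeds 5 - 3. *)
  - destruct (nat_above (exp 5)) as [X HX]; assert (H5 := exp_ineq1_le 5).
    exists (INR X); split; [split; [simpl (INR 0); lra | auto]|].
    assert (HN' : 2 * INR X + 1 <= INR (2 * X + 1))
      by (rewrite plus_INR, mult_INR; simpl; lra).
    assert (H := proj2 (digammaR_rate (INR X) (INR X) (2 * X + 1)
      ltac:(rewrite Rabs_pos_eq; lra) HN') _ (Nat.le_refl _)).
    apply Rabs_le_between in H.
    assert (H' := digamma_approx_ge (2 * X + 1) (INR X) ltac:(lra)).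
    rewrite S_INR in H'.
    assert (E : INR (2 * X + 1) = 2 * INR X + 1) by (rewrite plus_INR, mult_INR; simpl; lra).
    rewrite E in *.
    replace ((2 * INR X + 1) / (2 * INR X + 1)) with 1 in H by (field; lra).
    assert ((2 * INR X + 1 + 1) / INR X <= 3)
      by (apply (Rmult_le_reg_r (INR X)); [lra|]; field_simplify; lra).
    assert (5 < ln (2 * INR X + 1)).
    { rewrite <- (ln_exp 5); apply ln_increasing; [apply exp_pos | lra]. }
    lra.
  - destruct (digamma_approx_near_pole n k 1 ltac:(lia)) as [e [He [_ Hhi]]].
    exists (- INR k - e); split; [apply gap_left_of_pole, He|].
    rewrite S_INR in HN, Hk0; assert (H := pos_INR k).
    assert (Hq := HN n (- INR k - e) ltac:(lia) ltac:(apply Rabs_le_between; lra)).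
    apply Rabs_le_between in Hq; lra. }
destruct Hq as [q [Hq Hhi]].
apply (gap_IVT digammaR k (- INR k + d) q); trivial.
- apply gap_right_of_pole, Hd.
- intros x Hx; apply digammaR_continuity; intros j; apply (gap_not_pole k j x Hx).
- apply digammaR_gap_lt.
- lra.
Qed.

(** Strong induction on k, with [alpha k] in gap j. If j < k, it would equal [alpha j], the only
    zero of that gap. If k < j, the zero of gap k is some [alpha m] to the right of [alpha k], so m
    < k, yet [alpha m] lies in gap m by induction. *)
Lemma gap_decr_zeros (alpha : nat -> R) :
  (forall k, alpha (S k) < alpha k) ->
  (forall z, digamma_zero z <-> exists k, z = RtoC (alpha k)) ->
  forall k, gap k (alpha k) /\ digammaR (alpha k) = 0.
Proof.
intros decr zeros.
assert (lt : forall i j, (i < j)%nat -> alpha j < alpha i).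
{ intros i j; induction 1 as [|j _ IH]; [apply decr | specialize (decr j); lra]. }
assert (zero : forall k, (forall j, alpha k + INR j <> 0) /\ digammaR (alpha k) = 0).
{ intros k; apply digamma_zero_RtoC, zeros; exists k; reflexivity. }
intros k; split; [|apply zero].
induction k as [k IHk] using (well_founded_ind Nat.lt_wf_0).
destruct (gap_cover (alpha k) (proj1 (zero k))) as [j Hj].
destruct (Nat.lt_trichotomy j k) as [H|[<-|H]]; [|exact Hj|].
- assert (E : alpha k = alpha j).
  { apply (digammaR_gap_inj j); [exact Hj | apply IHk, H|].
    rewrite (proj2 (zero k)), (proj2 (zero j)); reflexivity. }
  specialize (lt j k H); lra.
- destruct (digammaR_gap_zero k) as [a [Ha a0]].
  assert (Hm : exists m, RtoC a = RtoC (alpha m)).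
  { apply zeros, digamma_zero_RtoC; split; [|exact a0].
    intros i; apply (gap_not_pole k i a Ha). }
  destruct Hm as [m Hm]; injection Hm as Em; rewrite Em in Ha.
  assert (Hlt := gap_lt k j _ _ Ha Hj H).
  assert (mk : (m < k)%nat).
  { destruct (Nat.lt_trichotomy m k) as [H'|[->|H']]; [exact H' | lra|].
    specialize (lt k m H'); lra. }
  assert (m = k) by (apply (gap_inj m k (alpha m)); [apply IHk, mk | exact Ha]); lia.
Qed.

(** * Convergence of the zeros and of the sums over them *)

Lemma gap_zeros_lim (b : nat -> R) (k n0 : nat) (a : R) :
  gap k a -> digammaR a = 0 ->
  (forall n, (n0 <= n)%nat -> gap k (b n) /\ digamma_approx n (b n) = 0) ->
  is_lim_seq b a.
Proof.
intros Ha a0 Hb; apply is_lim_seq_spec; intros eps.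
destruct (gap_open k a eps Ha (cond_pos eps)) as [d [Hd [Hl Hr]]].
assert (lo := digammaR_gap_lt k (a - d) a Hl Ha ltac:(lra)).
assert (hi := digammaR_gap_lt k a (a + d) Ha Hr ltac:(lra)).
rewrite a0 in lo, hi.
(* The tolerances are the distances of the limits from 0, so for large n [digamma_approx n] is
   negative at a - d and positive at a + d. Its monotonicity then traps [b n] between the two. *)
assert (Llo := proj2 (is_lim_seq_spec _ _) (digammaR_lim (a - d)) (mkposreal (- digammaR (a - d)) ltac:(lra))).
assert (Lhi := proj2 (is_lim_seq_spec _ _) (digammaR_lim (a + d)) (mkposreal _ hi)).
destruct Llo as [n1 H1]; destruct Lhi as [n2 H2]; exists (max n0 (max n1 n2)); intros n Hn.
specialize (H1 n ltac:(lia)); specialize (H2 n ltac:(lia)); simpl in H1, H2.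
apply Rabs_lt_between in H1; apply Rabs_lt_between in H2.
destruct (Hb n ltac:(lia)) as [Gb Eb].
assert (Hlo : a - d < b n).
{ destruct (Rtotal_order (a - d) (b n)) as [H|[H|H]]; [exact H | rewrite H in H1; lra|].
  assert (H' := digamma_approx_gap_lt n k _ _ Gb Hl H); lra. }
assert (Hhi : b n < a + d).
{ destruct (Rtotal_order (b n) (a + d)) as [H|[H|H]]; [exact H | rewrite <- H in H2; lra|].
  assert (H' := digamma_approx_gap_lt n k _ _ Hr Gb H); lra. }
apply Rabs_lt_between; lra.
Qed.

(* Dominated convergence for series, with the domination given as a bound on tails. *)
Lemma is_series_tannery (f : nat -> nat -> R) (a c : nat -> R) (s : R) (k0 : nat) :
  (forall k, is_lim_seq (fun n => f n k) (a k)) ->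
  is_lim_seq (fun n => sum_n (f n) n) s ->
  (forall m n, (k0 <= m <= n)%nat -> Rabs (sum_n (f n) n - sum_n (f n) m) <= c m) ->
  is_lim_seq c 0 -> is_series a s.
Proof.
intros Hf Hs Hc c0.
assert (partial : forall m, is_lim_seq (fun n => sum_n (f n) m) (sum_n a m)).
{ induction m as [|m IHm].
  - apply is_lim_seq_ext with (fun n => f n 0%nat); [intros n; rewrite sum_O; reflexivity|].
    rewrite sum_O; apply Hf.
  - apply is_lim_seq_ext with (fun n => sum_n (f n) m + f n (S m));
      [intros n; rewrite sum_Sn; reflexivity|].
    rewrite sum_Sn; apply is_lim_seq_plus'; [exact IHm | apply Hf]. }
assert (H : is_lim_seq (sum_n a) s); [|exact H].
apply is_lim_seq_ext with (fun m => s - (s - sum_n a m)); [intros m; ring|].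
replace (Finite s) with (Finite (s - 0)) by (f_equal; ring).
apply is_lim_seq_minus'; [apply is_lim_seq_const|].
apply is_lim_seq_abs_0, is_lim_seq_le_le_loc with (fun _ => 0) c;
  [|apply is_lim_seq_const | exact c0].
exists k0; intros m Hm; split; [apply Rabs_pos|].
apply (is_lim_seq_le_loc (fun n => Rabs (sum_n (f n) n - sum_n (f n) m)) (fun _ => c m)
  (Finite (Rabs (s - sum_n a m))) (Finite (c m))).
- exists m; intros n Hn; apply Hc; lia.
- apply (is_lim_seq_abs _ (Finite _)), is_lim_seq_minus'; [exact Hs | apply partial].
- apply is_lim_seq_const.
Qed.

(** Here x < -(k + 1), and 1 / (k + 1)^2 is weakened to 1 / (k (k + 1)) so that the tails
    telescope. *)
Lemma gap_inv_sqr_le (k : nat) (x : R) : (1 <= k)%nat -> gap (S (S k)) x ->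
  0 <= / x ^ 2 <= / INR k - / INR (S k).
Proof.
intros Hk [_ [Hx|Hx]]; [discriminate|].
assert (Hk' : 0 < INR k) by (apply lt_0_INR; lia); rewrite !S_INR in *.
split; [apply Rlt_le, Rinv_0_lt_compat; nra|].
replace (/ INR k - / (INR k + 1)) with (/ (INR k * (INR k + 1))) by (field; lra).
apply Rinv_le_contravar; nra.
Qed.

Lemma gap_sum_tail (b : nat -> R) (m n : nat) : (2 <= m <= n)%nat ->
  (forall k, (k <= n)%nat -> gap k (b k)) ->
  0 <= sum_n (fun k => / b k ^ 2) n - sum_n (fun k => / b k ^ 2) m
    <= / INR (m - 1) - / INR (n - 1).
Proof.
intros [Hm Hn]; induction Hn as [|n Hn IHn]; intros Hb; [lra|].
specialize (IHn (fun k Hk => Hb k ltac:(lia))).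
rewrite sum_Sn; unfold plus; cbn -[INR pow Nat.sub].
destruct n as [|n]; [lia|].
assert (H := gap_inv_sqr_le n (b (S (S n))) ltac:(lia) (Hb _ (Nat.le_refl _))).
replace (S (S n) - 1)%nat with (S n) by lia; replace (S n - 1)%nat with n in IHn by lia.
cbn -[INR pow Nat.sub] in *; lra.
Qed.

(* The term j = 0 vanishes, as / 0 = 0. *)
Lemma sum_n_inv_INR (p n : nat) : (0 < p)%nat ->
  sum_n (fun j => / INR j ^ p) n = sum_n_m (fun j => / INR j ^ p) 1 n.
Proof.
intros Hp; unfold sum_n; rewrite sum_Sn_m by lia.
change (INR 0) with 0; rewrite pow_i, Rinv_0 by exact Hp; exact (Rplus_0_l _).
Qed.

Lemma digamma_approx_0 (n : nat) :
  digamma_approx n 0 = ln (INR n) - sum_n_m (fun j => / INR j) 1 n.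
Proof.
unfold digamma_approx; f_equal.
rewrite (sum_n_ext _ (fun j => / INR j ^ 1)), sum_n_inv_INR by
  (try lia; intros j; rewrite Rplus_0_l, pow_1; reflexivity).
apply sum_n_m_ext; intros j; rewrite pow_1; reflexivity.
Qed.

Lemma Euler_gamma_digammaR : Euler_gamma = - digammaR 0.
Proof.
unfold digammaR, Euler_gamma.
rewrite <- (Rbar_opp_real (Lim_seq _)), <- Lim_seq_opp; f_equal; apply Lim_seq_ext.
intros n; rewrite digamma_approx_0; symmetry; apply Ropp_minus_distr.
Qed.

Lemma sum_inv_sqr_zeros_lim :
  is_lim_seq (fun n => digamma_approx n 0 ^ 2 + 3 * sum_n_m (fun j => / INR j ^ 2) 1 n)
    (Euler_gamma ^ 2 + PI ^ 2 / 2).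
Proof.
replace (Euler_gamma ^ 2 + PI ^ 2 / 2) with (digammaR 0 ^ 2 + 3 * (PI ^ 2 / 6))
  by (rewrite Euler_gamma_digammaR; field).
apply is_lim_seq_plus'; [|apply is_lim_seq_mult'; [apply is_lim_seq_const|]].
- apply is_lim_seq_ext with (fun n => digamma_approx n 0 * digamma_approx n 0);
    [intros n; ring|].
  replace (digammaR 0 ^ 2) with (digammaR 0 * digammaR 0) by ring.
  apply is_lim_seq_mult'; apply digammaR_lim.
- apply is_lim_seq_incr_1, is_lim_seq_ext with (sum_n (fun k => / (INR k + 1) ^ 2));
    [|exact is_series_inv_sqr].
  intros n; unfold sum_n; rewrite <- sum_n_m_S.
  apply sum_n_m_ext; intros j; rewrite S_INR; reflexivity.
Qed.

(** The zeros are distinct because they lie in n + 1 disjoint gaps. The square of H_n - ln n appears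
    as that of [digamma_approx n 0], whose singular term is 0. *)
Lemma digamma_approx_zeros_sum (n : nat) (b : nat -> R) : (2 <= n)%nat ->
  (forall k, (k <= n)%nat -> gap k (b k) /\ digamma_approx n (b k) = 0) ->
  sum_n (fun k => / b k ^ 2) n =
    digamma_approx n 0 ^ 2 + 3 * sum_n_m (fun j => / INR j ^ 2) 1 n.
Proof.
intros Hn Hb; assert (Hln : 0 < ln (INR n)).
{ rewrite <- ln_1; apply ln_increasing; [lra|]; apply (lt_INR 1); lia. }
assert (zero : forall k, (k <= n)%nat -> sum_n (fun j => / (b k + INR j)) n = ln (INR n)).
{ intros k Hk; assert (H := proj2 (Hb k Hk)); unfold digamma_approx in H; lra. }
rewrite (real_log_deriv_roots_sum_inv_sqr n (ln (INR n))); [|lra| | |exact zero].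
- rewrite sum_n_inv_INR by lia; f_equal; unfold digamma_approx.
  rewrite (sum_n_ext (fun j => / (0 + INR j)) (fun j => / INR j));
    [ring | intros j; rewrite Rplus_0_l; reflexivity].
- intros i j Hi Hj E; apply (gap_inj i j (b i)); [apply Hb, Hi | rewrite E; apply Hb, Hj].
- intros k j Hk; apply (gap_not_pole k), Hb, Hk.
Qed.

Theorem mainTheorem3 (alpha : nat -> R)
  (alpha_decr : forall k : nat, alpha (S k) < alpha k)
  (alpha_zeros : forall z : C,
     digamma_zero z <-> exists k : nat, z = RtoC (alpha k)) :
  is_series (fun k : nat => 1 / alpha k ^ 2) (Euler_gamma ^ 2 + PI ^ 2 / 2).
Proof.
assert (Ha := gap_decr_zeros alpha alpha_decr alpha_zeros).
(* [b n k] is specified for 2 <= n and k <= n; for fixed k this covers all large n, and the n-th sum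
   stops at k = n. *)
set (b n k := epsilon (inhabits 0) (fun x => gap k x /\ digamma_approx n x = 0)).
assert (b_spec : forall n, (2 <= n)%nat -> forall k, (k <= n)%nat ->
  gap k (b n k) /\ digamma_approx n (b n k) = 0).
{ intros n Hn k Hk; apply epsilon_spec, digamma_approx_gap_zero; trivial. }
apply is_series_ext with (fun k => / alpha k ^ 2);
  [intros k; unfold Rdiv; rewrite Rmult_1_l; reflexivity|].
apply (is_series_tannery (fun n k => / b n k ^ 2) _ (fun m => / INR (m - 1)) _ 2).
- intros k; destruct (Ha k) as [Gk Ek].
  assert (Hlim : is_lim_seq (fun n => b n k) (alpha k)).
  { apply (gap_zeros_lim _ k (max 2 k)); trivial.
    intros n Hn; apply b_spec; lia. }
  apply (is_lim_seq_continuous (fun x => / x ^ 2) _ _); [|exact Hlim].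
  apply continuity_pt_filterlim, (ex_derive_continuous (fun x => / x ^ 2)).
  auto_derive.
  assert (H := gap_not_pole k 0 _ Gk); simpl in H; rewrite Rplus_0_r in H.
  rewrite Rmult_1_r; apply Rmult_integral_contrapositive_currified; exact H.
- apply is_lim_seq_ext_loc with (2 := sum_inv_sqr_zeros_lim).
  exists 2%nat; intros n Hn; symmetry; apply digamma_approx_zeros_sum; [exact Hn|].
  apply b_spec, Hn.
- intros m n Hmn.
  assert (H := gap_sum_tail (b n) m n Hmn (fun k Hk => proj1 (b_spec n ltac:(lia) k Hk))).
  assert (0 < / INR (n - 1)) by (apply Rinv_0_lt_compat, lt_0_INR; lia).
  apply Rabs_le_between; lra.
- apply is_lim_seq_incr_1, is_lim_seq_ext with (fun n => / INR n).
  { intros n; do 2 f_equal; lia. }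
  apply (is_lim_seq_inv INR p_infty); [apply is_lim_seq_INR | discriminate].
Qed.
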